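(* Let $G=(V,E)$ be a network graph with local dimension $d\ge 2$, and let $\rho$ be a state on the network Hilbert space. Put $$p_T=\mathrm{Tr}\Big(\rho\,\Big[\bigotimes_{e\in T}\Phi_e\otimes\bigotimes_{e\notin T}(\mathbb{I}_e-\Phi_e)\Big]\Big),\qquad T\subseteq E,$$ (so that $p_T=\prod_{e\in T}\mathrm{Tr}(\rho_e\Phi_e)\prod_{e\notin T}(1-\mathrm{Tr}(\rho_e\Phi_e))$ if $\rho=\bigotimes_{e\in E}\rho_e$). Consider the linear program in real variables $w_T$ ($T\subseteq E$) and $q_T(S)$ ($T\subseteq E$, $S$ a nontrivial subset of $V$): $$\text{maximize } -\sum_{T\subseteq E}w_Tp_T\quad\text{subject to}\quad q_T(S)\le w_T,\qquad 0\le\sum_{T\subseteq T(S)}q_{T\cup\tilde T}(S)\,\mathbf{x}_T(S)\le d^{|T(S)|}\ \text{(componentwise)},$$ where the constraints run over all $T\subseteq E$, all nontrivial $S\subseteq V$ and all $\tilde T\subseteq E\setminus T(S)$, and $\mathbf{x}_T(S)=\bigotimes_{e\in T}(1,-1)\otimes\bigotimes_{e\in T(S)\setminus T}(d-1,d+1)\in\mathbb{R}^{2^{|T(S)|}}$ (the factor of each edge of $T(S)$ placed at its position in a fixed ordering of $T(S)$). Then the optimal value of this linear program is a lower bound on the GME negativity $\mathcal{N}(\rho)$. Moreover, if $\rho=\bigotimes_{e\in E}\rho_e$ where every $\rho_e$ is white-noised, i.e. $\rho_e=p_e\Phi_e+(1-p_e)\mathbb{I}_e/d^2$ with $p_e\in[0,1]$,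 then the optimal value equals $\mathcal{N}(\rho)$.
   Context: Network: $G=(V,E)$ is a finite connected simple undirected graph with $|V|\ge2$; vertices are parties. To each edge $e=\{u,v\}$ is attached $\mathcal{H}_e=\mathbb{C}^d\otimes\mathbb{C}^d$, one tensor factor held by $u$ and the other by $v$; the network Hilbert space is $\bigotimes_{e\in E}\mathcal{H}_e$, and each party $v$ holds all factors located at $v$. $\mathbb{I}_e$ is the identity on $\mathcal{H}_e$ and $\Phi_e=|\phi^+\rangle\langle\phi^+|$ with $|\phi^+\rangle=\frac1{\sqrt d}\sum_{i=0}^{d-1}|ii\rangle$. A subset $S\subseteq V$ is nontrivial if $S\ne\emptyset,V$. $\Gamma_S$ denotes the partial transpose (computational basis) on all tensor factors held by parties in $S$. $T(S)\subseteq E$ is the set of edges with exactly one endpoint in $S$. GME negativity: $\mathcal{N}_S(\sigma)$ is the sum of absolute values of the negative eigenvalues of $\sigma^{\Gamma_S}$, and $\mathcal{N}(\rho)=\min\sum_S p_S\mathcal{N}_S(\rho_S)$, the minimum over all decompositions $\rho=\sum_S p_S\rho_S$ with $S$ ranging over nontrivial subsets of $V$, $p_S\ge0$, $\rho_S\succeq0$, $\mathrm{Tr}\rho_S=1$. *)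

(* Defs.v *)
From HB Require Import structures.
From mathcomp Require Import all_boot all_order all_algebra.
From mathcomp Require Import complex.
From mathcomp Require Import classical_sets reals constructive_ereal ereal.

Set Implicit Arguments.
Unset Strict Implicit.
Unset Printing Implicit Defensive.

Import Order.TTheory GRing.Theory Num.Theory.

Local Open Scope ring_scope.
Local Open Scope sesquilinear_scope.

(* Operators on the Hilbert space with orthonormal (computational) basis       *)
(* indexed by I; the row of basis element x is [enum_rank x].                 *)
Definition operator (R : realType) (I : finType) := 'M[R[i]]_#|I|.

Definition psd (R : realType) n (A : 'M[R[i]]_n) : Prop :=
  A \is hermsymmx /\ forall v : 'cV[R[i]]_n, 0 <= (v^t* *m A *m v) 0 0.

Definition state (R : realType) n (A : 'M[R[i]]_n) : Prop :=
  psd A /\ \tr A = 1.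

Section Network.
Variables (V : finType) (adj : rel V).

(* Each undirected edge {u, v} is represented once, by its endpoints listed in *)
(* increasing order of [enum_rank]; this also fixes which of the two factors   *)
(* of C^d (x) C^d is held by which endpoint: the first one by (val e).1, the   *)
(* second one by (val e).2.                                                    *)
Definition edge : finType :=
  {uv : V * V | adj uv.1 uv.2 && (enum_rank uv.1 < enum_rank uv.2)%N}.

Definition nontrivial (S : {set V}) : bool := (S != finset.set0) && (S != [set: V]).

Definition cut (S : {set V}) : {set edge} :=
  [set e : edge | ((val e).1 \in S) != ((val e).2 \in S)].

Definition pair_basis (d : nat) := ('I_d * 'I_d)%type.

Definition network_basis (d : nat) := {ffun edge -> 'I_d * 'I_d}.

Variables (R : realType) (d : nat).

Definition edge_tensor (A : edge -> operator R (pair_basis d)) :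
    operator R (network_basis d) :=
  \matrix_(i, j) \prod_(e : edge)
    let x : network_basis d := enum_val i in
    let y : network_basis d := enum_val j in
    A e (enum_rank (x e)) (enum_rank (y e)).

(* The basis index agreeing with y on the factors held by S and with x on the  *)
(* other ones.                                                                 *)
Definition mix (S : {set V}) (x y : network_basis d) : network_basis d :=
  [ffun e : edge => (if (val e).1 \in S then (y e).1 else (x e).1,
                     if (val e).2 \in S then (y e).2 else (x e).2)].

Definition partial_transpose (S : {set V}) (A : operator R (network_basis d)) :
    operator R (network_basis d) :=
  \matrix_(i, j) A (enum_rank (mix S (enum_val i) (enum_val j)))
                   (enum_rank (mix S (enum_val j) (enum_val i))).

(* [spectral_diag] lists the eigenvalues, with multiplicity, of a normal       *)
(* matrix (it is 0 on other matrices); it is only used on Hermitian ones.      *)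
Definition negativity (S : {set V}) (A : operator R (network_basis d)) : R :=
  let lambda := spectral_diag (partial_transpose S A) in
  complex.Re (\sum_(i | lambda 0 i < 0) `|lambda 0 i|).

Definition decomposition (rho : operator R (network_basis d))
    (p : {set V} -> R) (sigma : {set V} -> operator R (network_basis d)) : Prop :=
  (forall S, nontrivial S -> 0 <= p S /\ state (sigma S)) /\
  rho = \sum_(S | nontrivial S) (real_complex R (p S)) *: sigma S.

(* For a state and at least two parties the infimum is over a nonempty set of  *)
(* nonnegative reals, and it is attained by compactness.                       *)
Definition gme_negativity (rho : operator R (network_basis d)) : R :=
  inf [set x : R | exists p sigma, decomposition rho p sigma /\
         x = \sum_(S | nontrivial S) p S * negativity S (sigma S)]%classic.

Definition phi_plus : 'cV[R[i]]_#|{: pair_basis d}| :=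
  \col_i (((enum_val i).1 == (enum_val i).2)%:R / sqrtC d%:R).

Definition Phi : operator R (pair_basis d) := phi_plus *m phi_plus^t*.

Definition white_noised (p : R) : operator R (pair_basis d) :=
  (real_complex R p) *: Phi + (real_complex R (1 - p) / d%:R ^+ 2) *: 1%:M.

(* The overlaps p_T; the trace is real when rho is Hermitian.                  *)
Definition overlap (rho : operator R (network_basis d)) (T : {set edge}) : R :=
  complex.Re (\tr (rho *m edge_tensor
    (fun e => if e \in T then Phi else 1%:M - Phi))).

(* The component of x_T(S) in R^(2^|T(S)|) at which exactly the edges of B,    *)
(* B a subset of T(S), select the second entry of their factor.                *)
Definition xvec (S : {set V}) (T B : {set edge}) : R :=
  (\prod_(e in T) (if e \in B then -1 else 1)) *
  (\prod_(e in cut S :\: T) (if e \in B then d%:R + 1 else d%:R - 1)).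

Definition lp_feasible (w : {set edge} -> R)
    (q : {set edge} -> {set V} -> R) : Prop :=
  (forall (T : {set edge}) (S : {set V}), nontrivial S -> q T S <= w T) /\
  (forall (S : {set V}) (T' : {set edge}), nontrivial S -> T' \subset ~: cut S ->
     forall B : {set edge}, B \subset cut S ->
     0 <= \sum_(T : {set edge} | T \subset cut S) q (T :|: T') S * xvec S T B
       <= d%:R ^+ #|cut S|).

(* Extended-real valued, so that an unbounded program would have value +oo.    *)
Definition lp_value (p : {set edge} -> R) : \bar R :=
  ereal_sup [set x : \bar R | exists w q, lp_feasible w q /\
               x = (- \sum_(T : {set edge}) w T * p T)%:E]%classic.

End Network.

(* Main.v *)
(* Write [W = sum_T w_T Phi_T] and [Q_S = sum_T q_T(S) Phi_T], where [Phi_T] is the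
   projector defining [p_T].  The first constraint says [W >= Q_S]; the second one
   says [0 <= Q_S^Gamma <= 1], because the vectors [x_T(S)] list [d^|T(S)|]
   times the eigenvalues of the partial transpose of [Phi_T] on the symmetric
   and antisymmetric subspaces of the cut edges.  Hence
   [- tr (rho W) <= - sum_S p_S tr (rho_S^Gamma Q_S^Gamma) <= sum_S p_S N_S(rho_S)].

   Conversely, an optimal dual solution (Farkas) consists of weights [lam_T(S)]
   summing over [S] to [p_T], and of nonnegative multipliers [mum, mup] of the
   symmetric/antisymmetric projectors.  Spreading [lam_T(S)] over the normalised
   projectors [Phi_T] gives operators [rho_S] that sum to a white-noised [rho], and
   the multipliers give a splitting [rho_S^Gamma = M^- - M^+] into positive
   operators, so that [p_S N_S(rho_S)] is at most [tr M^+], the dual objective. *)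
Require Import Defs.
From mathcomp Require Import all_boot all_order all_algebra.
From mathcomp Require Import complex.
From mathcomp Require Import ring lra.
From mathcomp Require Import boolp classical_sets reals constructive_ereal ereal.

Import Order.TTheory GRing.Theory Num.Theory.

Local Open Scope ring_scope.
Local Open Scope sesquilinear_scope.

(** * Linear programming duality *)

Section LinearProgramming.
Variable R : realFieldType.
Implicit Type V : lmodType R.

(** An unbundled predicate, so that the constraints built below can stay plain functions given by
    explicit formulas. *)
Definition linear_form V (f : V -> R) :=
  forall a x y, f (a *: x + y) = a * f x + f y.

Lemma linear_form0 {V} {f : V -> R} : linear_form V f -> f 0 = 0.
Proof.
move=> lf; have := lf 1 0 0.
rewrite scaler0 addr0 mul1r => /eqP.
by rewrite -subr_eq subrr eq_sym => /eqP.
Qed.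

Lemma linear_formZ {V} {f : V -> R} : linear_form V f -> forall a x, f (a *: x) = a * f x.
Proof. by move=> lf a x; rewrite -[a *: x]addr0 lf linear_form0 // addr0. Qed.

Lemma linear_formB {V} {f : V -> R} : linear_form V f ->
  forall a x y, f (x - a *: y) = f x - a * f y.
Proof. by move=> lf a x y; rewrite addrC -scaleNr lf mulNr addrC. Qed.

(* Bartl's induction on the number of inequalities: if the last one cannot be
   dropped, some z violates [g] and only the last inequality, and subtracting
   multiples of z projects onto the kernel of [A k]. *)
Lemma farkas V (J : eqType) (A : J -> V -> R) (s : seq J) (g : V -> R) :
  (forall j, linear_form V (A j)) -> linear_form V g -> uniq s ->
  (forall x, (forall j, j \in s -> A j x <= 0) -> g x <= 0) ->
  exists2 l : J -> R, (forall j, 0 <= l j) &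
    forall x, g x = \sum_(j <- s) l j * A j x.
Proof.
elim: s A g => [|k s IHs] A g Alin glin /=.
  move=> _ gle0; exists (fun=> 0) => // x; rewrite big_nil; apply/eqP.
  rewrite eq_le gle0 //= -oppr_le0 -mulN1r -(linear_formZ glin); exact: gle0.
move=> /andP[ks us] gle0.
have extend (l : J -> R) c : (forall j, 0 <= l j) -> 0 <= c ->
    (forall x, g x = \sum_(j <- s) l j * A j x + c * A k x) ->
    exists2 l' : J -> R, (forall j, 0 <= l' j) &
      forall x, g x = \sum_(j <- k :: s) l' j * A j x.
  move=> l0 c0 gE; exists (fun j => if j == k then c else l j) => [j|x].
    by case: ifP.
  rewrite big_cons eqxx gE addrC; congr (_ + _).
  apply: eq_big_seq => j js; case: eqP => // jk.
  by rewrite -jk js in ks.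
have [H|] := pselect (forall x, (forall j, j \in s -> A j x <= 0) -> g x <= 0).
  have [l l0 gE] := IHs A g Alin glin us H.
  by apply: (extend l 0) => // x; rewrite gE mul0r addr0.
move=> /existsNP[y /not_implyP[yA /negP]]; rewrite -ltNge => gy0.
have Aky0 : 0 < A k y.
  rewrite ltNge; apply: contraTN gy0 => Aky; rewrite -leNgt.
  by apply: gle0 => j; rewrite inE => /orP[/eqP->|/yA].
pose z := (A k y)^-1 *: y.
have zA j : j \in s -> A j z <= 0.
  move=> /yA Ajy; rewrite /z linear_formZ //.
  by rewrite mulr_ge0_le0 // invr_ge0 ltW.
have Akz : A k z = 1 by rewrite /z linear_formZ // mulVf // gt_eqF.
have gz : 0 < g z by rewrite /z linear_formZ // mulr_gt0 // invr_gt0.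
have plin f : linear_form V f -> linear_form V (fun x => f x - A k x * f z).
  by move=> lf a u v; rewrite lf Alin; ring.
have [||x Hx|l l0 gE] :=
  IHs (fun j x => A j x - A k x * A j z) (fun x => g x - A k x * g z) _ _ us.
- by move=> j; apply: plin.
- exact: plin.
- rewrite -linear_formB //; apply: gle0 => j; rewrite inE => /orP[/eqP->|/Hx].
    by rewrite linear_formB // Akz mulr1 subrr.
  by rewrite linear_formB.
(* This is the coefficient of [A k x] once the projected identity is expanded. It is nonnegative
   since [g z > 0] while [A j z <= 0] for [j] in [s]. *)
apply: (extend l (g z - \sum_(j <- s) l j * A j z)) => //.
  rewrite subr_ge0 (le_trans _ (ltW gz)) //.
  by rewrite big_seq sumr_le0 // => j js; rewrite mulr_ge0_le0 ?zA.
move=> x; have /eqP := gE x; rewrite subr_eq => /eqP ->.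
under eq_bigr do rewrite mulrBr mulrCA.
by rewrite sumrB -mulr_sumr; ring.
Qed.

(** Homogenisation: Farkas' lemma is applied to pairs [(x, t)] with [A j x <= b j * t] and [0 <= t],
    for the consequence [g x <= v * t]. *)
Lemma lp_strong_duality V (J : eqType) (A : J -> V -> R) (b : J -> R)
    (s : seq J) (g : V -> R) (v : R) :
  (forall j, linear_form V (A j)) -> linear_form V g -> uniq s ->
  (forall j, 0 <= b j) ->
  (forall x, (forall j, j \in s -> A j x <= b j) -> g x <= v) ->
  exists l : J -> R, [/\ forall j, 0 <= l j,
    forall x, g x = \sum_(j <- s) l j * A j x &
    \sum_(j <- s) l j * b j <= v].
Proof.
move=> Alin glin us b0 gv.
have Llin f (c : R) : linear_form V f ->
    linear_form (V * R^o)%type (fun x => f x.1 - c * x.2).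
  by move=> lf a x y /=; rewrite lf -[a *: x.2]/(a * x.2); ring.
(* [None] indexes the constraint [0 <= t], written [0 - 1 * x.2] to have the shape handled by
   [Llin]. *)
pose A' (j : option J) : (V * R^o)%type -> R :=
  if j is Some j then fun x => A j x.1 - b j * x.2 else fun x => 0 - 1 * x.2.
have us' : uniq (None :: map Some s).
  rewrite /= map_inj_uniq ?us ?andbT; last by move=> ? ? [].
  by apply/mapP => -[].
have [||[x t] Hx|l l0 gE] :=
  farkas _ _ A' _ (fun x => g x.1 - v * x.2) _ _ us'.
- case=> [j|]; first exact: Llin.
  by apply: (Llin (fun=> 0)) => a x y; rewrite mulr0 addr0.
- exact: Llin.
- have t0 : 0 <= t.
    by have := Hx None; rewrite inE eqxx => /(_ isT) /=; rewrite mul1r sub0r oppr_le0.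
  have Ax j : j \in s -> A j x <= b j * t.
    by move=> js; have := Hx (Some j); rewrite inE /= map_f // subr_le0 => ->.
  rewrite /= subr_le0.
  (* For [t = 0], [x] is a recession direction: if [g x > 0], its multiple by [(v + 1) / g x] is
     feasible because [b >= 0], yet has value [v + 1]. For [t > 0], [x] is rescaled by [t^-1]. *)
  move: t0; rewrite le_eqVlt => /predU1P[t0|t0].
    rewrite -t0 mulr0 leNgt; apply/negP => gx0.
    have v0 : 0 <= v.
      by rewrite -(linear_form0 glin) gv // => j _; rewrite linear_form0.
    have : g (((v + 1) / g x) *: x) <= v.
      apply: gv => j js; rewrite linear_formZ //.
      rewrite (le_trans _ (b0 j)) // mulr_ge0_le0 //.
        by rewrite divr_ge0 // ?addr_ge0 // ltW.
      by rewrite -(mulr0 (b j)) t0 Ax.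
    by rewrite linear_formZ // divfK ?gt_eqF //; lra.
  have : g (t^-1 *: x) <= v.
    apply: gv => j js; rewrite linear_formZ //.
    by rewrite mulrC ler_pdivrMr // Ax.
  by rewrite linear_formZ // mulrC ler_pdivrMr.
(* The Farkas identity at [(x, 0)] expands [g]; at [(0, -1)] it reads
   [v = l None + \sum_j l j * b j], and [l None >= 0]. *)
exists (fun j => l (Some j)); split => [//|x|].
  have := gE (x, 0); rewrite big_cons big_map /= !mulr0 !subr0 mulr0 add0r => ->.
  by apply: eq_bigr => j _; rewrite mulr0 subr0.
have := gE (0, -1); rewrite big_cons big_map /= (linear_form0 glin).
rewrite !sub0r !mulrN1 !opprK mulr1 => ->.
under [X in _ <= _ + X]eq_bigr do rewrite (linear_form0 (Alin _)) sub0r mulrN1 opprK.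
by rewrite lerDr.
Qed.

End LinearProgramming.

(** * Positive operators and negativity *)

Section ComplexMatrices.
Variable R : realType.
Local Notation C := R[i].

Lemma conjtmxM m n p (A : 'M[C]_(m, n)) (B : 'M[C]_(n, p)) :
  (A *m B)^t* = B^t* *m A^t*.
Proof. by rewrite trmx_mul map_mxM. Qed.

Lemma hermsymmxP n (A : 'M[C]_n) : reflect (A^t* = A) (A \is hermsymmx).
Proof.
rewrite is_hermitianmxE expr0 scale1r.
by apply: (iffP eqP) => [{2}->//|->].
Qed.

(** The diagonal entry is the quadratic form of [A] at the conjugate transpose of row [i] of [B]. *)
Lemma psd_gram n m (A : 'M[C]_n) (B : 'M[C]_(m, n)) i :
  psd A -> 0 <= (B *m A *m B^t*) i i.
Proof.
move=> [_ /(_ ((row i B)^t*))]; rewrite trmxCK -row_mul.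
have -> : (row i (B *m A) *m (row i B)^t*) 0 0 = (B *m A *m B^t*) i i => //.
by rewrite !mxE; apply: eq_bigr => j _; rewrite !mxE.
Qed.

Lemma psdD n (A B : 'M[C]_n) : psd A -> psd B -> psd (A + B).
Proof.
move=> [/hermsymmxP hA A0] [/hermsymmxP hB B0]; split.
  by apply/hermsymmxP; rewrite linearD map_mxD /= hA hB.
by move=> v; rewrite mulmxDr mulmxDl mxE addr_ge0.
Qed.

Lemma psd0 n : psd (0 : 'M[C]_n).
Proof.
split=> [|v]; first by apply/hermsymmxP; rewrite trmx0 map_mx0.
by rewrite mulmx0 mul0mx mxE.
Qed.

Lemma psdZ n (c : C) (A : 'M[C]_n) : 0 <= c -> psd A -> psd (c *: A).
Proof.
move=> c0 [/hermsymmxP hA A0]; split.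
  apply/hermsymmxP; rewrite linearZ map_mxZ /= hA; congr (_ *: _).
  by apply/CrealP; exact: ger0_real.
by move=> v; rewrite -scalemxAr -scalemxAl mxE mulr_ge0.
Qed.

Lemma psd_sum n (I : Type) (r : seq I) (P : pred I) (F : I -> 'M[C]_n) :
  (forall i, P i -> psd (F i)) -> psd (\sum_(i <- r | P i) F i).
Proof.
move=> F0; elim/big_rec: _ => [|i A Pi A0]; first exact: psd0.
by apply: psdD => //; exact: F0.
Qed.

Definition orthoproj n (P : 'M[C]_n) : Prop := P^t* = P /\ P *m P = P.

Lemma psd_orthoproj n (P : 'M[C]_n) : orthoproj n P -> psd P.
Proof.
move=> [hP PP]; split=> [|v]; first exact/hermsymmxP.
have -> : v^t* *m P *m v = (P *m v)^t* *m (P *m v).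
  by rewrite conjtmxM hP !mulmxA -(mulmxA _ P P) PP.
rewrite mxE sumr_ge0 // => i _; rewrite !mxE mulrC; exact: mul_conjC_ge0.
Qed.

(** By cyclicity the trace equals that of [P A P], whose diagonal is nonnegative. *)
Lemma mxtrace_psd_orthoproj n (A P : 'M[C]_n) :
  psd A -> orthoproj n P -> 0 <= \tr (A *m P).
Proof.
move=> A0 [hP PP]; rewrite -PP mulmxA mxtrace_mulC mulmxA.
by apply: sumr_ge0 => i _; have := psd_gram _ _ _ P i A0; rewrite hP.
Qed.

(** [negativity S A] unfolds to this quantity at the partial transpose of [A]; the two bounds below
    are its dual variational descriptions. *)
Definition negative_part n (A : 'M[C]_n) : R :=
  complex.Re (\sum_(i | spectral_diag A 0 i < 0) `|spectral_diag A 0 i|).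

Lemma spectral_diagE n (A : 'M[C]_n) i : A \is hermsymmx ->
  spectral_diag A 0 i = (spectralmx A *m A *m (spectralmx A)^t*) i i.
Proof.
move=> /hermitian_normalmx /orthomx_spectralP; set U := spectralmx A => {2}->.
have Uu : U \is unitarymx by exact: spectral_unitarymx.
rewrite invmx_unitary // !mulmxA (unitarymxP _) // mul1mx -mulmxA (unitarymxP _) //.
by rewrite mulmx1 mxE eqxx.
Qed.

Lemma negative_part_ge0 n (A : 'M[C]_n) : 0 <= negative_part n A.
Proof.
have : 0 <= \sum_(i | spectral_diag A 0 i < 0) `|spectral_diag A 0 i|.
  by rewrite sumr_ge0.
by rewrite lecE => /andP[].
Qed.

Lemma Re_le (x y : C) : x <= y -> complex.Re x <= complex.Re y.
Proof. by rewrite lecE => /andP[]. Qed.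

(** In an eigenbasis of [A] the trace is the sum of the [lambda_i q_i], where the diagonal entries
    [q_i] of [Q] lie in [0, 1]. So [- lambda_i q_i] is at most [|lambda_i|] for a negative
    eigenvalue and at most 0 otherwise. *)
Lemma negative_part_ge n (A Q : 'M[C]_n) :
  A \is hermsymmx -> psd Q -> psd (1%:M - Q) ->
  - complex.Re (\tr (A *m Q)) <= negative_part n A.
Proof.
move=> hA Q0 Q1; rewrite -[- _](raddfN (@complex.Re R)); apply: Re_le.
have Uu := spectral_unitarymx A.
have AE := orthomx_spectralP (hermitian_normalmx hA).
set U := spectralmx A in Uu AE *; set L := spectral_diag A in AE *.
have -> : \tr (A *m Q) = \sum_i L 0 i * (U *m Q *m U^t*) i i.
  rewrite AE invmx_unitary // -!mulmxA mxtrace_mulC -!mulmxA; apply: eq_bigr => i _.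
  by rewrite mul_diag_mx mxE !mulmxA.
rewrite -sumrN [leRHS]big_mkcond /=; apply: ler_sum => i _.
have Lr : L 0 i \is Num.real by apply: (mxOverP (hermitian_spectral_diag_real hA)).
have q0 := psd_gram _ _ _ U i Q0.
have q1 : (U *m Q *m U^t*) i i <= 1.
  rewrite -subr_ge0; have := psd_gram _ _ _ U i Q1.
  by rewrite mulmxBr mulmxBl mulmx1 (unitarymxP _) // 2!mxE (mxE _ _ i i) eqxx.
case: ifPn => L0.
  by rewrite ltr0_norm // -mulNr ler_piMr // oppr_ge0 ltW.
by rewrite oppr_le0 mulr_ge0 // real_leNgt // real0.
Qed.

(** In an eigenbasis of [A], [lambda_i = p_i - n_i] with [p_i, n_i >= 0]. Hence [|lambda_i| <= n_i]
    when [lambda_i < 0], and the other [n_i] only increase the trace of [N]. *)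
Lemma negative_part_le n (A P N : 'M[C]_n) :
  A = P - N -> psd P -> psd N -> negative_part n A <= complex.Re (\tr N).
Proof.
move=> AE P0 N0.
have hA : A \is hermsymmx.
  case: P0 N0 => [/hermsymmxP hP _] [/hermsymmxP hN _].
  by apply/hermsymmxP; rewrite AE linearB map_mxB /= hP hN.
apply: Re_le; have Uu := spectral_unitarymx A; set U := spectralmx A in Uu.
have -> : \tr N = \sum_i (U *m N *m U^t*) i i.
  transitivity (\tr (U *m N *m U^t*)) => //.
  by rewrite mxtrace_mulC mulmxA -invmx_unitary // mulVmx ?unitarymx_unit // mul1mx.
rewrite [leRHS](bigID (fun i => spectral_diag A 0 i < 0)) /= -[leLHS]addr0.
apply: lerD; last by apply: sumr_ge0 => i _; exact: psd_gram.
apply: ler_sum => i L0; rewrite ltr0_norm // spectral_diagE // -/U AE.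
rewrite mulmxBr mulmxBl mxE [X in _ + X]mxE opprB lerBlDr lerDl.
exact: psd_gram.
Qed.

End ComplexMatrices.

(** * Operators on a pair *)

Section Operators.
Variables (R : realType) (I : finType).
Implicit Types A B : operator R I.

Definition kernel_op (f : I -> I -> R[i]) : operator R I :=
  \matrix_(i, j) f (enum_val i) (enum_val j).

Lemma kernel_opE f x y : kernel_op f (enum_rank x) (enum_rank y) = f x y.
Proof. by rewrite mxE !enum_rankK. Qed.

Lemma operatorP A B :
  (forall x y, A (enum_rank x) (enum_rank y) = B (enum_rank x) (enum_rank y)) ->
  A = B.
Proof.
by move=> AB; apply/matrixP => i j; rewrite -(enum_valK i) -(enum_valK j).
Qed.

Lemma sum_enum_rank (F : 'I_#|I| -> R[i]) : \sum_i F i = \sum_x F (enum_rank x).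
Proof. exact: (reindex enum_rank (onW_bij _ (enum_rank_bij I))). Qed.

Lemma operatorM A B x y : (A *m B) (enum_rank x) (enum_rank y) =
  \sum_z A (enum_rank x) (enum_rank z) * B (enum_rank z) (enum_rank y).
Proof. by rewrite mxE sum_enum_rank. Qed.

Lemma operator_tr A : \tr A = \sum_x A (enum_rank x) (enum_rank x).
Proof. exact: sum_enum_rank. Qed.

Lemma operator1 x y : (1%:M : operator R I) (enum_rank x) (enum_rank y) = (x == y)%:R.
Proof. by rewrite mxE (inj_eq enum_rank_inj). Qed.

End Operators.

Section Pair.
Variables (R : realType) (d : nat) (d_gt1 : (1 < d)%N).
Local Notation C := R[i].
Local Notation op := (operator R (pair_basis d)).
Local Notation rk := enum_rank.
Local Notation Phi := (Phi R d).

Lemma dC_neq0 : d%:R != 0 :> C.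
Proof. by rewrite pnatr_eq0 -lt0n ltnW. Qed.

(** One-edge version of [mix]: [s1] and [s2] tell whether the endpoints belong to [S]. *)
Definition pair_mix (s1 s2 : bool) (x y : pair_basis d) : pair_basis d :=
  (if s1 then y.1 else x.1, if s2 then y.2 else x.2).

Definition pair_transpose (s1 s2 : bool) (A : op) : op :=
  kernel_op R _ (fun x y => A (rk (pair_mix s1 s2 x y)) (rk (pair_mix s1 s2 y x))).

Lemma pair_transposeD s1 s2 A B :
  pair_transpose s1 s2 (A + B) = pair_transpose s1 s2 A + pair_transpose s1 s2 B.
Proof. by apply/matrixP => i j; rewrite !mxE. Qed.

Lemma pair_transposeZ s1 s2 c A :
  pair_transpose s1 s2 (c *: A) = c *: pair_transpose s1 s2 A.
Proof. by apply/matrixP => i j; rewrite !mxE. Qed.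

Lemma pair_transpose1 s1 s2 : pair_transpose s1 s2 1%:M = 1%:M.
Proof.
apply: operatorP => -[a b] [a' b']; rewrite kernel_opE !operator1 /pair_mix /= !xpair_eqE.
by case: s1; case: s2; rewrite ?(eq_sym a') ?(eq_sym b').
Qed.

Definition swap : op :=
  kernel_op R _ (fun x y => ((x.1 == y.2) && (x.2 == y.1))%:R).

Lemma PhiE x y : Phi (rk x) (rk y) = ((x.1 == x.2) && (y.1 == y.2))%:R / d%:R.
Proof.
rewrite /Phi mxE big_ord1 !mxE !enum_rankK rmorphM fmorphV !rmorph_nat /=.
rewrite geC0_conj ?sqrtC_ge0 ?ler0n // mulrACA -invfM -expr2 sqrtCK.
by rewrite -natrM mulnb.
Qed.

(** Transposing one factor turns |ii><jj| into |ji><ij| or |ij><ji|, which sum to the swap.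
    Transposing both factors fixes [Phi], a real symmetric matrix. *)
Lemma pair_transpose_Phi s1 s2 :
  pair_transpose s1 s2 Phi = if s1 != s2 then d%:R^-1 *: swap else Phi.
Proof.
apply: operatorP => -[a b] [a' b']; rewrite kernel_opE PhiE /pair_mix.
case: s1; case: s2 => /=; rewrite ?PhiE /=; first by rewrite andbC.
- by rewrite mxE kernel_opE /= mulrC (eq_sym a') andbC.
- by rewrite mxE kernel_opE /= mulrC (eq_sym a').
- by [].
Qed.

Lemma pair_transpose_swap s1 s2 : s1 != s2 ->
  pair_transpose s1 s2 swap = d%:R *: Phi.
Proof.
move=> s12; apply: operatorP => -[a b] [a' b'].
rewrite kernel_opE [in RHS]mxE PhiE mulrCA divff ?dC_neq0 // mulr1 kernel_opE /pair_mix.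
by case: s1 s2 s12 => [] [] //= _; rewrite ?(eq_sym b') // andbC (eq_sym b).
Qed.

Lemma sum_diag : \sum_(x : pair_basis d) ((x.1 == x.2)%:R : C) = d%:R.
Proof.
rewrite -(pair_bigA _ (fun i j : 'I_d => (i == j)%:R)) /= (eq_bigr (fun=> 1)).
  by rewrite sumr_const card_ord.
move=> i _; rewrite (bigD1 i) //= eqxx big1 ?addr0 // => j.
by rewrite eq_sym => /negPf ->.
Qed.

Lemma PhiM : Phi *m Phi = Phi.
Proof.
apply: operatorP => x y; rewrite operatorM PhiE.
pose c : C := ((x.1 == x.2) && (y.1 == y.2))%:R / d%:R ^+ 2.
rewrite (eq_bigr (fun z : pair_basis d => c * (z.1 == z.2)%:R)) => [|z _].
  by rewrite -mulr_sumr sum_diag /c -mulrA expr2 invfM mulfVK ?dC_neq0.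
rewrite !PhiE /c mulrACA -natrM mulnb -invfM -expr2 mulrAC -natrM mulnb.
by case: (x.1 == _); case: (y.1 == _); case: (z.1 == _).
Qed.

Lemma PhiH : Phi^t* = Phi.
Proof. by rewrite /Defs.Phi conjtmxM trmxCK. Qed.

Lemma mxtrace_Phi : \tr Phi = 1.
Proof.
rewrite operator_tr (eq_bigr (fun x : pair_basis d => (x.1 == x.2)%:R / d%:R)).
  by rewrite -mulr_suml sum_diag divff ?dC_neq0.
by move=> x _; rewrite PhiE andbb.
Qed.

Lemma swapM : swap *m swap = 1%:M.
Proof.
apply: operatorP => -[a b] [a' b']; rewrite operatorM operator1 (bigD1 (b, a)) //=.
rewrite !kernel_opE /= !eqxx mul1r big1 ?addr0 => [|[u v]]; first by rewrite xpair_eqE andbC.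
rewrite !kernel_opE /= xpair_eqE negb_and => H.
by rewrite (eq_sym a) (eq_sym b); move: H; case: (u == b); case: (v == a) => //= _; rewrite mul0r.
Qed.

Lemma swapH : swap^t* = swap.
Proof.
apply: operatorP => -[a b] [a' b']; rewrite !mxE !enum_rankK conjC_nat /=.
by rewrite andbC (eq_sym a') (eq_sym b').
Qed.

Lemma mxtrace_swap : \tr swap = d%:R.
Proof.
rewrite operator_tr -sum_diag; apply: eq_bigr => x _.
by rewrite kernel_opE [x.2 == _]eq_sym andbb.
Qed.

Lemma mxtrace_pair1 : \tr (1%:M : op) = d%:R ^+ 2.
Proof. by rewrite mxtrace1 card_prod card_ord natrM expr2. Qed.

End Pair.

(** * Symmetric projectors of an edge *)

(** Used with [X] the identity and [W] the swap, to reduce operator identities on a cut edge to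
    identities between scalar coefficients. *)
Lemma scale_pencil (K : fieldType) (U : lmodType K) (a1 a2 h e1 e2 : K) (X W : U) :
  a1 *: (h *: (X + e1 *: W)) + a2 *: (h *: (X + e2 *: W)) =
  ((a1 + a2) * h) *: X + ((a1 * e1 + a2 * e2) * h) *: W.
Proof.
rewrite !scalerA !scalerDr !scalerA addrACA -!scalerDl.
by congr (_ *: _ + _ *: _); ring.
Qed.

Lemma scale_complement (K : fieldType) (U : lmodType K) (t u v : K) (X P : U) :
  t *: (u *: P + v *: (X - P)) = (t * v) *: X + (t * (u - v)) *: P.
Proof.
by rewrite scalerBr addrCA -scalerBl scalerDr !scalerA.
Qed.

Section EdgeProjectors.
Variables (R : realType) (d : nat) (d_gt1 : (1 < d)%N).
Local Notation C := R[i].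
Local Notation op := (operator R (pair_basis d)).
Local Notation rc := (real_complex R).
Local Notation Phi := (Phi R d).
Local Notation swap := (swap R d).
Local Notation pt := (pair_transpose R d).

Definition phi_proj (t : bool) : op := if t then Phi else 1%:M - Phi.

(* [c] tells whether the edge is cut; [b = true] is the antisymmetric subspace. *)
Definition cut_proj (c b : bool) : op :=
  if c then 2^-1 *: (1%:M + (if b then -1 else 1) *: swap) else phi_proj b.

(** This and [tr_cut] are the ranks of [phi_proj] and [cut_proj], as reals; they serve to normalise
    the projectors. *)
Definition tr_phi (t : bool) : R := if t then 1 else d%:R ^+ 2 - 1.

Definition tr_cut (c b : bool) : R :=
  if c then d%:R * (d%:R + (if b then -1 else 1)) / 2 else tr_phi b.

(* 1/d times an entry of the factor (1,-1) or (d-1,d+1) of x_T(S). *)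
Definition weight (c t b : bool) : R :=
  if c then (if t then (if b then -1 else 1)
             else (if b then d%:R + 1 else d%:R - 1)) / d%:R
  else (t == b)%:R.

Lemma dR_gt1 : 1 < d%:R :> R.
Proof. by rewrite ltr1n. Qed.

Lemma tr_phi_gt0 t : 0 < tr_phi t.
Proof. by have := dR_gt1; case: t => //=; nra. Qed.

Lemma tr_cut_gt0 c b : 0 < tr_cut c b.
Proof.
case: c; last exact: tr_phi_gt0.
rewrite /= divr_gt0 // mulr_gt0 //; have := dR_gt1; case: b; lra.
Qed.

Lemma phi_proj_orthoproj t : orthoproj R _ (phi_proj t).
Proof.
have [pH pM] := (PhiH R d, PhiM R d d_gt1).
case: t => //=; split; rewrite /=.
  by rewrite linearB map_mxB /= pH trmx1 map_mx1.
by rewrite mulmxBl !mulmxBr !mul1mx mulmx1 pM subrr subr0.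
Qed.

(** On a cut edge, [k *: swap] with [k] a sign is a Hermitian involution, so half of its sum with
    the identity is a projector. *)
Lemma cut_proj_orthoproj c b : orthoproj R _ (cut_proj c b).
Proof.
case: c; last exact: phi_proj_orthoproj.
have [sH sM] := (swapH R d, swapM R d).
have bb : (if b then -1 else 1) ^+ 2 = 1 :> C by case: b; rewrite ?sqrrN expr1n.
have bH : (if b then -1 else 1 : C)^* = if b then -1 else 1.
  by case: b {bb}; rewrite ?rmorphN rmorph1.
rewrite /cut_proj; set k : C := if b then -1 else 1 in bb bH *; split.
  rewrite linearZ linearD linearZ /= map_mxZ map_mxD map_mxZ /= sH trmx1 map_mx1.
  by rewrite bH fmorphV /= conjC_nat.
have kM : (k *: swap) *m (k *: swap) = 1%:M.
  by rewrite -scalemxAl -scalemxAr scalerA -expr2 bb sM scale1r.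
have AM : (1%:M + k *: swap) *m (1%:M + k *: swap) = 2 *: (1%:M + k *: swap).
  rewrite mulmxDl !mulmxDr !mul1mx mulmx1 kM (addrC (k *: swap)) -mulr2n.
  by rewrite scaler_nat.
by rewrite -scalemxAl -scalemxAr AM !scalerA -mulrA mulVf ?pnatr_eq0 // mulr1.
Qed.

Lemma mxtrace_phi_proj t : \tr (phi_proj t) = rc (tr_phi t).
Proof.
case: t; rewrite /phi_proj /tr_phi ?raddfB /= ?mxtrace_Phi ?mxtrace_pair1 ?rmorph1 //.
by rewrite rmorphXn rmorph_nat.
Qed.

Lemma mxtrace_cut_proj c b : \tr (cut_proj c b) = rc (tr_cut c b).
Proof.
case: c; last exact: mxtrace_phi_proj.
rewrite /cut_proj /tr_cut mxtraceZ mxtraceD mxtraceZ mxtrace_pair1 mxtrace_swap.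
by case: b; field.
Qed.

Lemma cut_projD c : cut_proj c true + cut_proj c false = 1%:M.
Proof.
case: c => /=; last by rewrite addrC subrK.
rewrite -[X in X + _]scale1r -[X in _ + X]scale1r scale_pencil.
have -> : (1 + 1) * 2^-1 = 1 :> C by field.
by rewrite mulrN1 mulr1 addNr mul0r scale0r addr0 scale1r.
Qed.

(** On a cut edge [Phi] becomes the swap divided by [d], with eigenvalues 1/d and -1/d on the
    symmetric and antisymmetric subspaces. On an uncut edge the projectors are fixed and [weight] is
    a Kronecker delta. *)
Lemma pair_transpose_phi_proj s1 s2 t (c := s1 != s2) :
  pt s1 s2 (phi_proj t) =
  rc (weight c t true) *: cut_proj c true + rc (weight c t false) *: cut_proj c false.
Proof.
have d0 := dC_neq0 R d d_gt1; have ptP := pair_transpose_Phi R d s1 s2.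
have -> : pt s1 s2 (phi_proj t) =
    (if t then 0 else 1) *: 1%:M + (if t then 1 else -1) *: pt s1 s2 Phi.
  case: t => /=; first by rewrite scale0r add0r scale1r.
  by rewrite -scaleN1r pair_transposeD pair_transposeZ pair_transpose1 scale1r.
rewrite {}ptP -/c /weight /cut_proj; case: c => /=.
  rewrite scale_pencil scalerA.
  by case: t => /=; congr (_ *: _ + _ *: _); field.
by case: t; rewrite /= ?scale0r ?scale1r ?add0r ?addr0 ?scaleN1r.
Qed.

(** The same weights occur with their indices exchanged, because partial transposition is
    self-adjoint for the trace pairing; the ranks account for the normalisation of the
    projectors. *)
Lemma pair_transpose_cut_proj s1 s2 b (c := s1 != s2) :
  pt s1 s2 (cut_proj c b) = rc (tr_cut c b) *:
   (rc (weight c true b / tr_phi true) *: phi_proj true +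
    rc (weight c false b / tr_phi false) *: phi_proj false).
Proof.
have d0 := dC_neq0 R d d_gt1.
have t0 : d%:R ^+ 2 - 1 != 0 :> C.
  have := tr_phi_gt0 false; rewrite lt0r -(inj_eq (@complexI R)) /= => /andP[+ _].
  by rewrite rmorph0 rmorphB rmorphXn rmorph_nat rmorph1.
rewrite /cut_proj -/c /tr_cut /weight /tr_phi; case: (boolP c) => [cT|cF].
  rewrite pair_transposeZ pair_transposeD pair_transposeZ pair_transpose1.
  rewrite pair_transpose_swap //.
  rewrite /phi_proj scale_complement scalerDr !scalerA.
  by case: b => /=; congr (_ *: _ + _ *: _); field; rewrite ?t0 ?d0.
have ptF : pt s1 s2 (phi_proj b) = phi_proj b.
  rewrite pair_transpose_phi_proj // -/c (negPf cF) /= /weight.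
  by case: b; rewrite /= ?scale0r ?scale1r ?add0r ?addr0.
rewrite ptF; case: b {ptF} => /=.
  by rewrite mul0r rmorph0 scale0r addr0 scalerA divr1 mulr1 scale1r.
rewrite mul0r rmorph0 scale0r add0r scalerA -rmorphM mul1r divff ?scale1r //.
by have := tr_phi_gt0 false; rewrite lt0r => /andP[].
Qed.

End EdgeProjectors.

(** * Network operators *)

Section NetworkOperators.
Variables (R : realType) (V : finType) (adj : rel V) (d : nat).
Local Notation C := R[i].
Local Notation rc := (real_complex R).
Local Notation rk := enum_rank.
Local Notation edge := (edge adj).
Local Notation basis := (network_basis adj d).
Local Notation op := (operator R basis).
Local Notation pop := (operator R (pair_basis d)).
Implicit Types (A B : edge -> pop) (M N : op) (S : {set V}) (T D : {set edge}).

Lemma edge_tensorE A (x y : basis) :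
  edge_tensor A (rk x) (rk y) = \prod_e A e (rk (x e)) (rk (y e)).
Proof. by rewrite mxE !enum_rankK. Qed.

Lemma eq_edge_tensor A B : A =1 B -> edge_tensor A = edge_tensor B.
Proof.
by move=> AB; apply: operatorP => x y; rewrite !edge_tensorE; apply: eq_bigr => e _; rewrite AB.
Qed.

Lemma edge_tensorM A B :
  edge_tensor A *m edge_tensor B = edge_tensor (fun e => A e *m B e).
Proof.
apply: operatorP => x y; rewrite operatorM edge_tensorE.
under [RHS]eq_bigr do rewrite operatorM.
rewrite bigA_distr_bigA; apply: eq_bigr => z _.
by rewrite !edge_tensorE big_split.
Qed.

Lemma mxtrace_edge_tensor A : \tr (edge_tensor A) = \prod_e \tr (A e).
Proof.
rewrite operator_tr; under [RHS]eq_bigr do rewrite operator_tr.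
by rewrite bigA_distr_bigA; apply: eq_bigr => x _; rewrite edge_tensorE.
Qed.

Lemma edge_tensor_conjt A : (edge_tensor A)^t* = edge_tensor (fun e => (A e)^t*).
Proof.
apply: operatorP => x y; rewrite 2!mxE !edge_tensorE rmorph_prod.
by apply: eq_bigr => e _; rewrite !mxE.
Qed.

Lemma edge_tensor_orthoproj A :
  (forall e, orthoproj R _ (A e)) -> orthoproj R _ (edge_tensor A).
Proof.
move=> Ap; split.
  by rewrite edge_tensor_conjt; apply: eq_edge_tensor => e; case: (Ap e).
by rewrite edge_tensorM; apply: eq_edge_tensor => e; case: (Ap e).
Qed.

Lemma edge_tensor1 : edge_tensor (fun _ : edge => 1%:M : pop) = 1%:M.
Proof.
apply: operatorP => x y; rewrite edge_tensorE operator1.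
have [<-|xy] := eqVneq x y.
  by rewrite big1 // => e _; rewrite operator1 eqxx.
have [e xye] : exists e, x e != y e.
  by apply/existsP; apply: contraNT xy; rewrite negb_exists => /forallP H;
    apply/eqP/ffunP => e; apply/eqP; rewrite -[_ == _]negbK H.
by rewrite (bigD1 e) //= operator1 (negPf xye) mul0r.
Qed.

(** Distributivity: choosing one of two terms at each edge amounts to choosing the set [T] of edges
    where the first is taken. *)
Lemma edge_tensor_expand (c : edge -> bool -> R) (P : edge -> bool -> pop) A :
  (forall e, A e = rc (c e true) *: P e true + rc (c e false) *: P e false) ->
  edge_tensor A = \sum_(T : {set edge})
    rc (\prod_e c e (e \in T)) *: edge_tensor (fun e => P e (e \in T)).
Proof.
move=> AE; apply: operatorP => x y; rewrite edge_tensorE summxE.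
pose p e b := rc (c e b) * P e b (rk (x e)) (rk (y e)).
rewrite (eq_bigr (fun e => p e true + p e false)) => [|e _]; last first.
  by rewrite AE mxE [X in X + _]mxE [X in _ + X]mxE.
rewrite bigA_distr; apply: eq_big => [T|T _]; first by rewrite inE.
rewrite [RHS]mxE edge_tensorE rmorph_prod -big_split.
by apply: eq_bigr => e _; case: ifP.
Qed.

(** * Partial transposition of network operators *)

Local Notation pT := (partial_transpose).

Lemma partial_transposeE S M x y : pT S M (rk x) (rk y) =
  M (rk (mix S x y)) (rk (mix S y x)).
Proof. by rewrite mxE !enum_rankK. Qed.

(** Exchanging the parts of [x] and [y] held by [S] is an involution on pairs of basis elements. *)
Lemma mixK S (x y : basis) : mix S (mix S x y) (mix S y x) = x.
Proof.
apply/ffunP => e; rewrite !ffunE /=.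
by case: (x e) => a b; case: (_.1 \in S); case: (_.2 \in S).
Qed.

Lemma partial_transposeK S M : pT S (pT S M) = M.
Proof. by apply: operatorP => x y; rewrite !partial_transposeE !mixK. Qed.

Lemma partial_transposeD S M N : pT S (M + N) = pT S M + pT S N.
Proof. by apply/matrixP => i j; rewrite !mxE. Qed.

Lemma partial_transpose0 S : pT S (0 : op) = 0.
Proof. by apply/matrixP => i j; rewrite !mxE. Qed.

Lemma partial_transposeZ S c M : pT S (c *: M) = c *: pT S M.
Proof. by apply/matrixP => i j; rewrite !mxE. Qed.

Lemma partial_transpose_sum S (I : Type) (r : seq I) (P : pred I) (F : I -> op) :
  pT S (\sum_(i <- r | P i) F i) = \sum_(i <- r | P i) pT S (F i).
Proof. exact: (big_morph _ (partial_transposeD S) (partial_transpose0 S)). Qed.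

Lemma partial_transpose_hermsym S M : M \is hermsymmx -> pT S M \is hermsymmx.
Proof.
move=> /hermsymmxP hM; apply/hermsymmxP; apply: operatorP => x y.
by rewrite 2!mxE !partial_transposeE -[in RHS]hM !mxE.
Qed.

(** Both traces are sums over pairs of basis elements, and the exchange of the [S]-parts reindexes
    one into the other. *)
Lemma mxtrace_partial_transposeM S M N : \tr (pT S M *m pT S N) = \tr (M *m N).
Proof.
rewrite !operator_tr.
under eq_bigr do rewrite operatorM.
under [RHS]eq_bigr do rewrite operatorM.
rewrite !pair_bigA /=.
rewrite [RHS](reindex_inj (h := fun z => (mix S z.1 z.2, mix S z.2 z.1))) /=.
  by apply: eq_bigr => z _; rewrite !partial_transposeE.
apply: (can_inj (g := fun z => (mix S z.1 z.2, mix S z.2 z.1))) => -[x y] /=.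
by rewrite !mixK.
Qed.

Lemma mem_cut S (e : edge) :
  (e \in cut adj S) = (((val e).1 \in S) != ((val e).2 \in S)).
Proof. by rewrite inE. Qed.

Lemma partial_transpose_edge_tensor S A : pT S (edge_tensor A) =
  edge_tensor (fun e => pair_transpose R d ((val e).1 \in S) ((val e).2 \in S) (A e)).
Proof.
apply: operatorP => x y; rewrite partial_transposeE !edge_tensorE.
by apply: eq_bigr => e _; rewrite kernel_opE !ffunE.
Qed.

(** * Tensor products of edge projectors *)

Hypothesis d_gt1 : (1 < d)%N.

Definition phi_tensor T : op := edge_tensor (fun e => phi_proj R d (e \in T)).

(** [D] selects the antisymmetric subspace on cut edges and [Phi] on the others, so that for fixed
    [S] these projectors resolve the identity of the whole network. *)
Definition cut_tensor S D : op :=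
  edge_tensor (fun e => cut_proj R d (e \in cut adj S) (e \in D)).

Definition tr_phi_tensor T : R := \prod_(e : edge) tr_phi R d (e \in T).

Definition tr_cut_tensor S D : R :=
  \prod_(e : edge) tr_cut R d (e \in cut adj S) (e \in D).

(** The eigenvalue of the partial transpose of [phi_tensor T] on the range of [cut_tensor S D]. It
    vanishes unless [T] and [D] agree off the cut. *)
Definition cut_weight S T D : R :=
  \prod_(e : edge) weight R d (e \in cut adj S) (e \in T) (e \in D).

Lemma tr_phi_tensor_gt0 T : 0 < tr_phi_tensor T.
Proof. by apply: prodr_gt0 => e _; exact: tr_phi_gt0. Qed.

Lemma tr_cut_tensor_gt0 S D : 0 < tr_cut_tensor S D.
Proof. by apply: prodr_gt0 => e _; exact: tr_cut_gt0. Qed.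

Lemma mxtrace_phi_tensor T : \tr (phi_tensor T) = rc (tr_phi_tensor T).
Proof.
rewrite mxtrace_edge_tensor rmorph_prod.
by apply: eq_bigr => e _; rewrite mxtrace_phi_proj.
Qed.

Lemma mxtrace_cut_tensor S D : \tr (cut_tensor S D) = rc (tr_cut_tensor S D).
Proof.
rewrite mxtrace_edge_tensor rmorph_prod.
by apply: eq_bigr => e _; rewrite mxtrace_cut_proj.
Qed.

Lemma phi_tensor_orthoproj T : orthoproj R _ (phi_tensor T).
Proof. by apply: edge_tensor_orthoproj => e; exact: phi_proj_orthoproj. Qed.

Lemma cut_tensor_orthoproj S D : orthoproj R _ (cut_tensor S D).
Proof. by apply: edge_tensor_orthoproj => e; exact: cut_proj_orthoproj. Qed.

Lemma sum_cut_tensor S : \sum_(D : {set edge}) cut_tensor S D = 1%:M.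
Proof.
rewrite -edge_tensor1 (edge_tensor_expand (fun _ _ => 1)
  (fun e => cut_proj R d (e \in cut adj S))).
  by apply: eq_bigr => D _; rewrite big1 // rmorph1 scale1r.
by move=> e; rewrite rmorph1 !scale1r cut_projD.
Qed.

Lemma partial_transpose_phi_tensor S T : pT S (phi_tensor T) =
  \sum_(D : {set edge}) rc (cut_weight S T D) *: cut_tensor S D.
Proof.
rewrite partial_transpose_edge_tensor.
apply: (edge_tensor_expand (fun e => weight R d (e \in cut adj S) (e \in T))
  (fun e => cut_proj R d (e \in cut adj S))) => e.
by rewrite pair_transpose_phi_proj // mem_cut.
Qed.

Lemma partial_transpose_cut_tensor S D : pT S (cut_tensor S D) =
  rc (tr_cut_tensor S D) *: \sum_(T : {set edge})
    rc (cut_weight S T D / tr_phi_tensor T) *: phi_tensor T.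
Proof.
rewrite partial_transpose_edge_tensor.
rewrite (edge_tensor_expand
  (fun e t => tr_cut R d (e \in cut adj S) (e \in D) *
     (weight R d (e \in cut adj S) t (e \in D) / tr_phi R d t))
  (fun _ t => phi_proj R d t)).
  rewrite scaler_sumr; apply: eq_bigr => T _; rewrite scalerA -rmorphM.
  by congr (rc _ *: _); rewrite !big_split prodfV.
move=> e; rewrite mem_cut pair_transpose_cut_proj //.
by rewrite scalerDr !scalerA -!rmorphM.
Qed.

End NetworkOperators.

(** * Weak duality *)

Definition mem_setE := (finset.in_setU, finset.in_setI, finset.in_setD).

Section NetworkLP.
Variables (R : realType) (V : finType) (adj : rel V) (d : nat).
Hypothesis d_gt1 : (1 < d)%N.
Local Notation C := R[i].
Local Notation rc := (real_complex R).
Local Notation edge := (edge adj).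
Local Notation basis := (network_basis adj d).
Local Notation op := (operator R basis).
Local Notation pop := (operator R (pair_basis d)).
Local Notation Phi := (Phi R d).
Local Notation pT := (partial_transpose).
Local Notation phi_tensor := (phi_tensor R V adj d).
Local Notation cut_tensor := (cut_tensor R V adj d).
Local Notation cut_weight := (cut_weight R V adj d).
Local Notation tr_phi_tensor := (tr_phi_tensor R V adj d).
Local Notation tr_cut_tensor := (tr_cut_tensor R V adj d).
Implicit Types (S : {set V}) (T D : {set edge}) (sigma : op).

Lemma overlapE sigma T : overlap sigma T = complex.Re (\tr (sigma *m phi_tensor T)).
Proof. by []. Qed.

Lemma overlap_ge0 sigma T : psd sigma -> 0 <= overlap sigma T.
Proof.
move=> s0; rewrite overlapE -[0]/(complex.Re (0 : C)); apply: Re_le.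
by apply: mxtrace_psd_orthoproj => //; exact: phi_tensor_orthoproj.
Qed.

Lemma overlap_edge_tensor (A : edge -> pop) (g : edge -> R) :
  (forall e, \tr (A e) = 1) -> (forall e, \tr (A e *m Phi) = rc (g e)) ->
  forall T, overlap (edge_tensor A) T =
    \prod_e (if e \in T then g e else 1 - g e).
Proof.
move=> A1 AP T; rewrite overlapE edge_tensorM mxtrace_edge_tensor.
rewrite (eq_bigr (fun e => rc (if e \in T then g e else 1 - g e))).
  by rewrite -rmorph_prod.
move=> e _; rewrite /phi_proj; case: ifP => // _.
by rewrite mulmxBr mulmx1 linearB /= A1 AP rmorphB rmorph1.
Qed.

Lemma overlap_product (sigma : edge -> pop) : (forall e, state (sigma e)) ->
  forall T, overlap (edge_tensor sigma) T =
    (\prod_(e in T) complex.Re (\tr (sigma e *m Phi))) *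
    (\prod_(e in ~: T) (1 - complex.Re (\tr (sigma e *m Phi)))).
Proof.
move=> st T.
rewrite (overlap_edge_tensor sigma (fun e => complex.Re (\tr (sigma e *m Phi)))).
- rewrite (bigID (mem T)) /=; congr (_ * _).
    by apply: eq_bigr => e ->.
  by apply: eq_big => [e|e /negPf ->]; rewrite ?inE.
- by move=> e; case: (st e).
(* The trace of a positive operator against a projector is real, so [complex.Re] loses nothing. *)
- move=> e; rewrite RRe_real // ger0_real //; apply: mxtrace_psd_orthoproj.
    by case: (st e).
  exact: (phi_proj_orthoproj R d d_gt1 true).
Qed.

(** Off the cut both sets agree and every factor is 1; on the cut each factor is an entry of x_T(S)
    divided by [d]. *)
Lemma cut_weightE S D T : T \subset cut adj S ->
  cut_weight S (T :|: (D :\: cut adj S)) D =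
  xvec R d S T (D :&: cut adj S) / d%:R ^+ #|cut adj S|.
Proof.
move=> TS; rewrite /(cut_weight _ _ _) (bigID (mem (cut adj S))) /=.
rewrite [X in _ * X]big1 ?mulr1 => [|e /negPf eS]; last first.
  by rewrite !mem_setE eS /= (contraFF (fintype.subsetP TS e) eS) eqxx.
rewrite (eq_bigr (fun e => (if e \in T then if e \in D :&: cut adj S then -1 else 1
    else if e \in D :&: cut adj S then d%:R + 1 else d%:R - 1) * d%:R^-1)).
  rewrite big_split prodr_const exprVn; congr (_ / _).
  rewrite (bigID (mem T)) /xvec /=; congr (_ * _).
    apply: eq_big => [e|e /andP[_ ->]] //.
    by apply: andb_idl; exact: (fintype.subsetP TS).
  by apply: eq_big => [e|e /andP[_ /negPf ->]] //; rewrite !mem_setE andbC.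
by move=> e eS; rewrite /weight !mem_setE eS /= orbF andbT.
Qed.

Lemma cut_weight_eq0 S D T : T :\: cut adj S != D :\: cut adj S ->
  cut_weight S T D = 0.
Proof.
move=> TD; have [e eTD] : exists e, (e \in T :\: cut adj S) != (e \in D :\: cut adj S).
  apply/existsP; apply: contraNT TD; rewrite negb_exists => /forallP H.
  by apply/eqP/setP => e; apply/eqP; rewrite -[_ == _]negbK H.
rewrite /(cut_weight _ _ _) (bigD1 e) //= /weight.
by move: eTD; rewrite !mem_setE; case: (e \in cut adj S) => //= /negPf ->; rewrite mul0r.
Qed.

(** Only the sets agreeing with [D] off the cut contribute, and they are determined by their
    intersection with the cut. *)
Lemma sum_cut_weight (f : {set edge} -> R) S D :
  \sum_T f T * cut_weight S T D =
  (\sum_(T : {set edge} | T \subset cut adj S)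
     f (T :|: (D :\: cut adj S)) * xvec R d S T (D :&: cut adj S))
  / d%:R ^+ #|cut adj S|.
Proof.
rewrite (bigID (fun T : {set edge} => T :\: cut adj S == D :\: cut adj S)) /= addrC.
rewrite big1 ?add0r => [|T TD]; last by rewrite cut_weight_eq0 ?mulr0.
rewrite (reindex_onto (fun T : {set edge} => T :|: (D :\: cut adj S))
  (fun T => T :&: cut adj S)) /=; last first.
  by move=> T /eqP <-; rewrite finset.setID.
rewrite mulr_suml.
have cutU T : T \subset cut adj S ->
    ((T :|: (D :\: cut adj S)) :\: cut adj S == D :\: cut adj S) &&
    ((T :|: (D :\: cut adj S)) :&: cut adj S == T).
  move=> /fintype.subsetP TS; apply/andP; split; apply/eqP/setP => e; rewrite !mem_setE.
    by case: (boolP (e \in T)) => [/TS ->|_] //=; case: (e \in cut adj S).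
  by case: (boolP (e \in T)) => [/TS ->|_] //=; case: (e \in cut adj S); rewrite ?andbF.
apply: eq_big => [T|T /andP[_ /eqP TS]].
  by apply/idP/idP => [/andP[_ /eqP <-]|/cutU //]; exact: finset.subsetIr.
by rewrite cut_weightE ?mulrA // -TS finset.subsetIr.
Qed.

(* [D] merges the indices of [lp_feasible]: [B] and [T'] are its parts inside and
   outside [cut S]. *)
Definition lp_feasible_diag (w : {set edge} -> R) (q : {set edge} -> {set V} -> R) :=
  (forall T S, nontrivial S -> q T S <= w T) /\
  (forall S D, nontrivial S -> 0 <= \sum_T q T S * cut_weight S T D <= 1).

(** [sum_cut_weight] identifies the constraints up to the positive factor [d ^ |cut S|], which turns
    the upper bound into 1. *)
Lemma lp_feasibleP w q : lp_feasible d w q <-> lp_feasible_diag w q.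
Proof.
have d0 n : 0 < d%:R ^+ n :> R by rewrite exprn_gt0 // ltr0n ltnW.
split=> -[wq H]; split=> // S.
  move=> D ntS; rewrite sum_cut_weight.
  have /andP[H0 H1] := H S (D :\: cut adj S) ntS (finset.subsetDr _ _)
    (D :&: cut adj S) (finset.subsetIr _ _).
  by rewrite divr_ge0 ?(ltW (d0 _)) //= ler_pdivrMr // mul1r.
move=> T' ntS T'S B BS; have := H S (B :|: T') ntS.
rewrite sum_cut_weight.
have memB e : e \in B -> e \in cut adj S by exact: fintype.subsetP.
have memT' e : e \in T' -> e \notin cut adj S.
  by move/(fintype.subsetP T'S); rewrite finset.in_setC.
have -> : (B :|: T') :\: cut adj S = T'.
  apply/setP => e; rewrite !mem_setE.
  case: (boolP (e \in T')) => [/memT' ->|_]; first by rewrite orbT.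
  by case: (boolP (e \in B)) => [/memB ->|_] //=; rewrite andbF.
have -> : (B :|: T') :&: cut adj S = B.
  apply/setP => e; rewrite !mem_setE.
  case: (boolP (e \in B)) => [/memB ->|_] //=.
  by case: (boolP (e \in T')) => [/memT' /negPf ->|_].
rewrite ler_pdivrMr // mul1r => /andP[H0 ->]; rewrite andbT.
by move: H0; rewrite pmulr_lge0 // invr_gt0.
Qed.

Lemma Re_rcM (a : R) (z : C) : complex.Re (rc a * z) = a * complex.Re z.
Proof. by case: z => x y /=; rewrite mul0r subr0. Qed.

Lemma Re_mxtrace_sum (I : Type) (r : seq I) (P : pred I) (F : I -> op) :
  complex.Re (\tr (\sum_(i <- r | P i) F i)) =
  \sum_(i <- r | P i) complex.Re (\tr (F i)).
Proof.
apply: (big_morph (fun M : op => complex.Re (\tr M))); last by rewrite mxtrace0.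
by move=> M N; rewrite mxtraceD; case: (\tr M) (\tr N) => [x1 y1] [x2 y2].
Qed.

Lemma psd_comb (I : finType) (c : I -> R) (F : I -> op) :
  (forall i, 0 <= c i) -> (forall i, orthoproj R _ (F i)) ->
  psd (\sum_i rc (c i) *: F i).
Proof.
move=> c0 Fp; apply: psd_sum => i _; apply: psdZ; first by rewrite ler0c.
exact: psd_orthoproj.
Qed.

(** As the overlaps are nonnegative, [q <= w] bounds the objective by minus the trace of [sigma]
    against [Q]. Partial transposition preserves this trace, and the other constraints put the
    spectrum of the transposed [Q] in [0, 1], so [negative_part_ge] applies. *)
Lemma lp_le_negativity w q sigma S : lp_feasible d w q -> nontrivial S -> psd sigma ->
  - \sum_T w T * overlap sigma T <= negativity S sigma.
Proof.
move=> /lp_feasibleP[wq H] ntS s0.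
pose k D := \sum_T q T S * cut_weight S T D.
pose Q := \sum_T rc (q T S) *: phi_tensor T.
have QE : pT S Q = \sum_D rc (k D) *: cut_tensor S D.
  rewrite partial_transpose_sum.
  under eq_bigr do rewrite partial_transposeZ partial_transpose_phi_tensor // scaler_sumr.
  rewrite exchange_big; apply: eq_bigr => D _ /=.
  rewrite /k rmorph_sum scaler_suml; apply: eq_bigr => T _.
  by rewrite scalerA -rmorphM.
have -> : negativity S sigma = negative_part R _ (pT S sigma) by [].
apply: le_trans (negative_part_ge R _ (pT S sigma) (pT S Q) _ _ _).
- rewrite mxtrace_partial_transposeM lerN2.
  rewrite mulmx_sumr Re_mxtrace_sum; apply: ler_sum => T _.
  rewrite -scalemxAr mxtraceZ Re_rcM -overlapE.
  by rewrite ler_wpM2r ?overlap_ge0 ?wq.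
- by apply: partial_transpose_hermsym; case: s0.
- rewrite QE; apply: psd_comb => D; last exact: cut_tensor_orthoproj.
  by have /andP[] := H S D ntS.
(* The complement is expanded in the same projectors, with coefficients [1 - k D]. *)
- rewrite QE -(sum_cut_tensor R V adj d S) -sumrB.
  rewrite (eq_bigr (fun D => rc (1 - k D) *: cut_tensor S D)).
    apply: psd_comb => D; last exact: cut_tensor_orthoproj.
    by rewrite subr_ge0; have /andP[] := H S D ntS.
  by move=> D _; rewrite rmorphB rmorph1 scalerBl scale1r.
Qed.

(** The objective is linear in the state, so the bounds for the components add up with their
    weights. *)
Lemma lp_le_decomposition w q sigma p tau : lp_feasible d w q ->
  decomposition sigma p tau ->
  - \sum_T w T * overlap sigma T <= \sum_(S | nontrivial S) p S * negativity S (tau S).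
Proof.
move=> fwq [ptau ->].
have -> : - (\sum_T w T * overlap (\sum_(S | nontrivial S) rc (p S) *: tau S) T) =
    \sum_(S | nontrivial S) p S * (- \sum_T w T * overlap (tau S) T).
  under [RHS]eq_bigr do rewrite mulrN mulr_sumr.
  rewrite sumrN exchange_big; congr (- _); apply: eq_bigr => T _ /=.
  rewrite overlapE mulmx_suml Re_mxtrace_sum mulr_sumr.
  apply: eq_bigr => S _.
  by rewrite -scalemxAl mxtraceZ Re_rcM mulrCA.
apply: ler_sum => S ntS; have [p0 [tau0 _]] := ptau S ntS.
by rewrite ler_wpM2l //; exact: lp_le_negativity fwq _ _.
Qed.

End NetworkLP.

(** * Dual solutions and decompositions *)

Section NetworkDual.
Variables (R : realType) (V : finType) (adj : rel V) (d : nat).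
Hypothesis d_gt1 : (1 < d)%N.
Local Notation C := R[i].
Local Notation rc := (real_complex R).
Local Notation edge := (edge adj).
Local Notation basis := (network_basis adj d).
Local Notation op := (operator R basis).
Local Notation pop := (operator R (pair_basis d)).
Local Notation Phi := (Phi R d).
Local Notation pT := (partial_transpose).
Local Notation phi_tensor := (phi_tensor R V adj d).
Local Notation cut_tensor := (cut_tensor R V adj d).
Local Notation cut_weight := (cut_weight R V adj d).
Local Notation tr_phi_tensor := (tr_phi_tensor R V adj d).
Local Notation tr_cut_tensor := (tr_cut_tensor R V adj d).
Implicit Types (S : {set V}) (T D : {set edge}) (sigma : op).

Lemma sum_indicator (I : finType) (P : pred I) (i : I) (F : I -> R) :
  \sum_(j | P j) F j * (j == i)%:R = if P i then F i else 0.
Proof.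
case: ifP => Pi.
  rewrite (bigD1 i) //= eqxx mulr1 big1 ?addr0 // => j /andP[_ /negPf ->].
  by rewrite mulr0.
by rewrite big1 // => j Pj; case: eqP Pj => [->|_]; rewrite ?Pi ?mulr0.
Qed.

(** [lam], [mup] and [mum] are the multipliers of [q <= w] and of the upper and lower bounds. The
    primal variables are unconstrained in sign, so the dual constraints are equalities. *)
Lemma lp_dual_solution (p : {set edge} -> R) (v : R) :
  (forall w q, lp_feasible d w q -> - \sum_T w T * p T <= v) ->
  exists lam mup mum : {set edge} -> {set V} -> R,
  [/\ (forall T S, 0 <= lam T S) /\
      (forall D S, 0 <= mup D S /\ 0 <= mum D S),
      forall T, p T = \sum_(S | nontrivial S) lam T S,
      forall T S, nontrivial S ->
        lam T S = \sum_D (mum D S - mup D S) * cut_weight S T D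
    & \sum_(S | nontrivial S) \sum_D mup D S <= v].
Proof.
move=> pv.
pose K := ({set edge} * {set V})%type.
pose U : lmodType R := ({ffun {set edge} -> R^o} * {ffun K -> R^o})%type.
(* A point [x] is a pair [(w, q)]; here [k = (D, S)], whereas for [q <= w] the index is [(T, S)]. *)
pose h (k : K) (x : U) : R := \sum_T x.2 (T, k.2) * cut_weight k.2 T k.1.
pose A (j : K + (K + K)) (x : U) : R :=
  match j with
  | inl k => x.2 k - x.1 k.1
  | inr (inl k) => h k x
  | inr (inr k) => - h k x
  end.
pose b (j : K + (K + K)) : R := if j is inr (inl _) then 1 else 0.
pose nt (j : K + (K + K)) :=
  nontrivial (match j with inl k => k.2 | inr (inl k) => k.2 | inr (inr k) => k.2 end).
pose g (x : U) : R := - \sum_T x.1 T * p T.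
have hlin k : linear_form R U (h k).
  move=> a x y; rewrite /h mulr_sumr -big_split; apply: eq_bigr => T _.
  by rewrite !ffunE /= -[a *: _]/(a * _); ring.
have Alin j : linear_form R U (A j).
  case: j => [k|[k|k]] a x y /=; rewrite ?hlin //; last by ring.
  by rewrite !ffunE /= -![a *: _]/(a * _); ring.
have glin : linear_form R U g.
  move=> a x y; rewrite /g mulrN -opprD mulr_sumr -big_split; congr (- _).
  by apply: eq_bigr => T _; rewrite !ffunE /= -[a *: _]/(a * _); ring.
(* Only the constraints of nontrivial [S] belong to the program. *)
pose s := [seq j <- index_enum _ | nt j].
have us : uniq s by rewrite filter_uniq ?index_enum_uniq.
have memS j : (j \in s) = nt j by rewrite mem_filter mem_index_enum andbT.
have b0 j : 0 <= b j by case: j => [?|[?|?]] /=.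
have gv x : (forall j, j \in s -> A j x <= b j) -> g x <= v.
  move=> Hx; apply: (pv _ (fun T S => x.2 (T, S))); apply/lp_feasibleP => //.
  split=> [T S ntS|S D ntS].
    by have := Hx (inl (T, S)); rewrite memS => /(_ ntS); rewrite /= subr_le0.
  have := Hx (inr (inl (D, S))); rewrite memS => /(_ ntS) /= ->; rewrite andbT.
  by have := Hx (inr (inr (D, S))); rewrite memS => /(_ ntS) /=; rewrite oppr_le0.
have [l [l0 gE lb]] := lp_strong_duality R U _ A b s g v Alin glin us b0 gv.
have sumJ (F : K + (K + K) -> R) : \sum_(j <- s) F j =
    \sum_(T : {set edge}) \sum_(S | nontrivial S) F (inl (T, S)) +
    (\sum_(S | nontrivial S) \sum_(D : {set edge}) F (inr (inl (D, S))) +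
     \sum_(S | nontrivial S) \sum_(D : {set edge}) F (inr (inr (D, S)))).
  rewrite big_filter !big_sumType /= pair_big; congr (_ + _).
    by apply: eq_big => -[].
  rewrite [in RHS]exchange_big [X in _ = _ + X]exchange_big !pair_big.
  by congr (_ + _); apply: eq_big => -[].
exists (fun T S => l (inl (T, S))), (fun D S => l (inr (inl (D, S)))),
  (fun D S => l (inr (inr (D, S)))); split.
- by split=> // D S; split.
- move=> T.
  (* Comparing the coefficients of [w_T]: both sides are evaluated at its unit vector. *)
  have := gE ([ffun T' => (T' == T)%:R], 0); rewrite sumJ /g /= => /eqP.
  have h0 k : h k ([ffun T' => (T' == T)%:R], 0) = 0.
    by rewrite /h big1 // => T' _; rewrite ffunE mul0r.
  rewrite [X in _ + (X + _)]big1 => [|S _]; last first.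
    by rewrite big1 // => D _; rewrite h0 mulr0.
  rewrite [X in _ + (_ + X)]big1 => [|S _]; last first.
    by rewrite big1 // => D _; rewrite h0 oppr0 mulr0.
  rewrite !addr0 eq_sym.
  under [X in _ == - X]eq_bigr do rewrite ffunE mulrC.
  rewrite sum_indicator /=.
  under eq_bigr => T' _ do under eq_bigr => S _ do
    rewrite !ffunE sub0r mulrN.
  under eq_bigr => T' _ do rewrite sumrN -mulr_suml.
  by rewrite sumrN (sum_indicator _ predT) /= eqr_opp => /eqP.
- move=> T S ntS.
  (* Likewise for [q_T(S)], on which the objective does not depend. *)
  have := gE (0, [ffun k => (k == (T, S))%:R]); rewrite sumJ /g /=.
  rewrite big1 => [|T' _]; last by rewrite ffunE mul0r.
  rewrite oppr0.
  have hE D S' : h (D, S') (0, [ffun k => (k == (T, S))%:R]) =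
      cut_weight S T D * (S' == S)%:R.
    rewrite /h (eq_bigr (fun T' => (cut_weight S' T' D * (S' == S)%:R) * (T' == T)%:R)).
      rewrite (sum_indicator _ predT) /=.
      by case: eqP => [->|]; rewrite ?mulr0.
    by move=> T' _; rewrite ffunE xpair_eqE /= -mulnb natrM; ring.
  have sumE (c : {set edge} -> {set V} -> R) :
      \sum_(S' | nontrivial S') \sum_D c D S' * (cut_weight S T D * (S' == S)%:R)
      = \sum_D c D S * cut_weight S T D.
    under eq_bigr => S' _ do under eq_bigr => D _ do rewrite mulrA.
    under eq_bigr => S' _ do rewrite -mulr_suml.
    by rewrite (sum_indicator _ (@nontrivial V)) ntS.
  rewrite (eq_bigr (fun T' => (\sum_(S' | nontrivial S') l (inl (T', S')) * (S' == S)%:R)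
      * (T' == T)%:R)); last first.
    move=> T' _; rewrite mulr_suml; apply: eq_bigr => S' _.
    by rewrite !ffunE subr0 xpair_eqE -mulnb natrM; ring.
  rewrite (sum_indicator _ predT) /= (sum_indicator _ (@nontrivial V)) ntS.
  under [X in _ + (X + _)]eq_bigr => S' _ do under eq_bigr => D _ do rewrite hE.
  under [X in _ + (_ + X)]eq_bigr => S' _ do under eq_bigr => D _ do
    rewrite hE mulrN -mulNr.
  rewrite (sumE (fun D S' => l (inr (inl (D, S'))))).
  rewrite (sumE (fun D S' => - l (inr (inr (D, S'))))).
  rewrite -big_split /= => /esym/eqP; rewrite addr_eq0 => /eqP ->.
  by rewrite -sumrN; apply: eq_bigr => D _; ring.
(* Only the upper bounds have a nonzero right-hand side, namely 1. *)
- move: lb; rewrite sumJ /=.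
  rewrite big1 => [|T _]; last by rewrite big1 // => S _; rewrite mulr0.
  rewrite [X in _ + (_ + X)]big1 => [|S _]; last by rewrite big1 // => D _; rewrite mulr0.
  rewrite add0r addr0.
  by under eq_bigr => S _ do under eq_bigr => D _ do rewrite mulr1.
Qed.

(** * White-noised states and the decomposition given by a dual solution *)

Lemma mxtrace_white_noised p : \tr (white_noised d p) = 1 :> C.
Proof.
rewrite /white_noised mxtraceD !mxtraceZ mxtrace_Phi // mxtrace_pair1 mulr1.
by rewrite divfK ?expf_neq0 ?dC_neq0 // rmorphB rmorph1 addrC subrK.
Qed.

Definition white_fidelity (p : R) : R := p + (1 - p) / d%:R ^+ 2.

Lemma mxtrace_white_noised_Phi p :
  \tr (white_noised d p *m Phi) = rc (white_fidelity p).
Proof.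
rewrite /white_noised mulmxDl -!scalemxAl PhiM // mul1mx mxtraceD !mxtraceZ.
rewrite mxtrace_Phi // !mulr1 /white_fidelity [RHS]rmorphD fmorph_div /=.
by rewrite rmorphXn rmorph_nat.
Qed.

Lemma white_noisedE p : white_noised d p =
  rc (white_fidelity p / tr_phi R d true) *: phi_proj R d true +
  rc ((1 - white_fidelity p) / tr_phi R d false) *: phi_proj R d false.
Proof.
have d0 : d%:R != 0 :> R by rewrite pnatr_eq0 -lt0n ltnW.
have t0 : d%:R ^+ 2 - 1 != 0 :> R.
  by have := tr_phi_gt0 R d d_gt1 false; rewrite lt0r => /andP[].
have -> : (1 - white_fidelity p) / tr_phi R d false = (1 - p) / d%:R ^+ 2.
  by rewrite /white_fidelity /tr_phi; field; rewrite t0 d0.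
rewrite /tr_phi divr1 /white_fidelity [rc (p + _)]rmorphD scalerDl /=.
rewrite scalerBr -addrA [X in _ = _ + X]addrC subrK.
by rewrite /white_noised [rc (_ / _)]fmorph_div rmorphXn rmorph_nat.
Qed.

(** Each factor is a combination of [Phi] and its complement, so the whole state is recovered from
    its overlaps. This is how white noise enters the equality case. *)
Lemma white_noised_edge_tensorE (p : edge -> R) (rho : op) :
  rho = edge_tensor (fun e => white_noised d (p e)) ->
  rho = \sum_T rc (overlap rho T / tr_phi_tensor T) *: phi_tensor T.
Proof.
move=> ->; pose f e t : R := if t then white_fidelity (p e) else 1 - white_fidelity (p e).
rewrite [LHS](edge_tensor_expand R V adj d
  (fun e t => f e t / tr_phi R d t) (fun _ t => phi_proj R d t)).
  apply: eq_bigr => T _; congr (rc _ *: _).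
  rewrite big_split prodfV (overlap_edge_tensor R V adj d _ (fun e => white_fidelity (p e))) //.
    by move=> e; exact: mxtrace_white_noised.
  by move=> e; exact: mxtrace_white_noised_Phi.
by move=> e; exact: white_noisedE.
Qed.

Lemma gme_negativity_le_dual (rho : op) (lam mup mum : {set edge} -> {set V} -> R) :
  state rho ->
  rho = \sum_T rc (overlap rho T / tr_phi_tensor T) *: phi_tensor T ->
  (forall T S, 0 <= lam T S) ->
  (forall D S, 0 <= mup D S /\ 0 <= mum D S) ->
  (forall T, overlap rho T = \sum_(S | nontrivial S) lam T S) ->
  (forall T S, nontrivial S ->
     lam T S = \sum_D (mum D S - mup D S) * cut_weight S T D) ->
  gme_negativity rho <= \sum_(S | nontrivial S) \sum_D mup D S.
Proof.
move=> st_rho rhoE lam0 mu0 lam_sum lamE.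
(* The unnormalised component of [S]; its trace [P S] is the weight of the component. *)
pose tau S : op := \sum_T rc (lam T S / tr_phi_tensor T) *: phi_tensor T.
pose M (mu : {set edge} -> {set V} -> R) S : op :=
  \sum_D rc (mu D S / tr_cut_tensor S D) *: cut_tensor S D.
have M0 mu S : (forall D S, 0 <= mu D S) -> psd (M mu S).
  move=> mu_ge0; apply: psd_comb => D; last exact: cut_tensor_orthoproj.
  by rewrite divr_ge0 // ltW // tr_cut_tensor_gt0.
have trM mu S : \tr (M mu S) = rc (\sum_D mu D S).
  rewrite /M raddf_sum rmorph_sum; apply: eq_bigr => D _.
  rewrite [LHS]mxtraceZ mxtrace_cut_tensor // -rmorphM divfK //.
  by rewrite gt_eqF // tr_cut_tensor_gt0.
have tau0 S : psd (tau S).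
  apply: psd_comb => T; last exact: phi_tensor_orthoproj.
  by rewrite divr_ge0 // ltW // tr_phi_tensor_gt0.
pose P S := \sum_T lam T S.
have trtau S : \tr (tau S) = rc (P S).
  rewrite /tau raddf_sum rmorph_sum; apply: eq_bigr => T _.
  rewrite [LHS]mxtraceZ mxtrace_phi_tensor // -rmorphM divfK //.
  by rewrite gt_eqF // tr_phi_tensor_gt0.
have ptM mu S : pT S (M mu S) =
    \sum_T rc ((\sum_D mu D S * cut_weight S T D) / tr_phi_tensor T) *: phi_tensor T.
  rewrite /M partial_transpose_sum.
  rewrite (eq_bigr (fun D => \sum_T rc (mu D S * cut_weight S T D / tr_phi_tensor T)
      *: phi_tensor T)) => [|D _].
    rewrite exchange_big; apply: eq_bigr => T _ /=.
    by rewrite -scaler_suml -rmorph_sum -mulr_suml.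
  rewrite partial_transposeZ partial_transpose_cut_tensor // !scaler_sumr.
  apply: eq_bigr => T _; rewrite !scalerA -!rmorphM; congr (rc _ *: _).
  by rewrite !mulrA divfK ?gt_eqF ?tr_cut_tensor_gt0.
(* Transposing back with [partial_transposeK] reduces this to the dual equation [lamE], coefficient
   by coefficient. *)
have tauE S : nontrivial S -> pT S (tau S) = M mum S - M mup S.
  move=> ntS; rewrite -[RHS](partial_transposeK R V adj d S); congr (pT S _).
  rewrite partial_transposeD -scaleN1r partial_transposeZ scaleN1r !ptM -sumrB.
  apply: eq_bigr => T _; rewrite -scalerBl -rmorphB -mulrBl -sumrB lamE //.
  by congr (rc (_ / _) *: _); apply: eq_bigr => D _; rewrite mulrBl.
have P0 S : 0 <= P S by exact: sumr_ge0.
have PS0 S : P S = 0 -> tau S = 0.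
  move=> /eqP; rewrite psumr_eq0 // => /allP lamS0.
  rewrite /tau big1 // => T _; have /eqP -> := lamS0 T (mem_index_enum _).
  by rewrite mul0r rmorph0 scale0r.
(* A component of weight 0 must still be a state; [rho] is the default. *)
pose sigma S : op := if P S == 0 then rho else rc (P S)^-1 *: tau S.
have ge0_mup S : 0 <= \sum_D mup D S by apply: sumr_ge0 => D _; case: (mu0 D S).
apply: (@le_trans _ _ (\sum_(S | nontrivial S) P S * negativity S (sigma S))).
  (* The values are bounded below by 0, and [P], [sigma] form one admissible decomposition. *)
  apply: ge_inf.
    exists 0 => _ [p' [sigma' [[st' _] ->]]]; apply: sumr_ge0 => S ntS.
    have [p0 _] := st' S ntS; rewrite mulr_ge0 //.
    exact: negative_part_ge0.
  exists P, sigma; split=> //; split=> [S ntS|].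
    split=> //; rewrite /sigma; case: eqP => // /eqP PSn0; split.
      by apply: psdZ => //; rewrite ler0c invr_ge0.
    by rewrite mxtraceZ trtau -rmorphM mulVf // rmorph1.
  rewrite {1}rhoE; transitivity (\sum_(S | nontrivial S) tau S).
    rewrite /tau exchange_big; apply: eq_bigr => T _ /=.
    by rewrite -scaler_suml -rmorph_sum -mulr_suml -lam_sum.
  apply: eq_bigr => S _; rewrite /sigma; case: eqP => [PS|/eqP PSn0].
    by rewrite PS0 // PS rmorph0 scale0r.
  by rewrite scalerA -rmorphM divff // rmorph1 scale1r.
apply: ler_sum => S ntS; rewrite /sigma; case: eqP => [->|/eqP PSn0].
  by rewrite mul0r.
have rc0 : 0 <= rc (P S)^-1 by rewrite ler0c invr_ge0.
have : negative_part R _ (pT S (rc (P S)^-1 *: tau S)) <= (P S)^-1 * \sum_D mup D S.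
  have <- : complex.Re (\tr (rc (P S)^-1 *: M mup S)) = (P S)^-1 * \sum_D mup D S.
    by rewrite mxtraceZ trM -rmorphM.
  apply: (negative_part_le R _ _ (rc (P S)^-1 *: M mum S)).
  - by rewrite partial_transposeZ tauE // scalerBr.
  - by apply: psdZ => //; apply: M0 => D S'; case: (mu0 D S').
  - by apply: psdZ => //; apply: M0 => D S'; case: (mu0 D S').
move=> /(ler_wpM2l (P0 S)); by rewrite mulVKf.
Qed.

Lemma exists_nontrivial : (1 < #|V|)%N -> exists S, nontrivial S.
Proof.
move=> V1; have /card_gt0P[x _] : (0 < #|V|)%N by apply: ltnW.
exists [set x]%SET; apply/andP; split.
  by apply/eqP => /setP/(_ x); rewrite finset.in_set1 eqxx finset.in_set0.
by apply: contraTneq V1 => /(congr1 (fun A : {set V} => #|A|)); rewrite cards1 cardsT => <-.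
Qed.

End NetworkDual.

(** * Lower bound for all states, equality under white noise *)

Theorem mainTheorem2 (R : realType) (V : finType) (adj : rel V)
    (adj_sym : symmetric adj) (adj_irr : irreflexive adj)
    (adj_connected : forall u v : V, connect adj u v)
    (V_gt1 : (1 < #|V|)%N)
    (d : nat) (d_gt1 : (1 < d)%N)
    (rho : operator R (network_basis adj d)) (rho_state : state rho) :
  [/\ forall sigma : edge adj -> operator R (pair_basis d),
        (forall e, state (sigma e)) -> rho = edge_tensor sigma ->
        forall T : {set edge adj},
          overlap rho T =
            (\prod_(e in T) complex.Re (\tr (sigma e *m Phi R d))) *
            (\prod_(e in ~: T) (1 - complex.Re (\tr (sigma e *m Phi R d)))),
      (lp_value d (overlap rho) <= (gme_negativity rho)%:E)%E
    & forall p : edge adj -> R,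
        (forall e, 0 <= p e <= 1) ->
        rho = edge_tensor (fun e => white_noised d (p e)) ->
        lp_value d (overlap rho) = (gme_negativity rho)%:E ].
Proof.
have feasible_le w q : lp_feasible d w q ->
    - \sum_T w T * overlap rho T <= gme_negativity rho.
  move=> fwq; apply: lb_le_inf.
    (* The infimum is over a nonempty set: all the weight can be put on [rho] at a single nontrivial
       [S0]. *)
    have [S0 ntS0] := exists_nontrivial V V_gt1.
    exists (\sum_(S | nontrivial S) (S == S0)%:R * negativity S rho).
    exists (fun S => (S == S0)%:R), (fun=> rho); split=> //; split=> [S _|].
      by split.
    rewrite (bigD1 S0) //= eqxx rmorph1 scale1r big1 ?addr0 // => S /andP[_ /negPf ->].
    by rewrite rmorph0 scale0r.
  move=> _ [p [tau [dec ->]]].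
  exact: lp_le_decomposition fwq dec.
have lp_le : (lp_value d (overlap rho) <= (gme_negativity rho)%:E)%E.
  by apply: ge_ereal_sup => _ [w [q [fwq ->]]]; rewrite lee_fin; exact: feasible_le fwq.
split=> // [sigma st_sigma ->|p p01 rhoE]; first exact: overlap_product.
apply/eqP; rewrite eq_le lp_le /=.
have feasible_lp w q : lp_feasible d w q ->
    ((- \sum_T w T * overlap rho T)%:E <= lp_value d (overlap rho))%E.
  by move=> fwq; apply: ereal_sup_ubound; exists w, q.
have feasible0 : @lp_feasible V adj R d (fun=> 0) (fun _ _ => 0).
  split=> // S T' _ _ B _; rewrite big1 ?lexx ?exprn_ge0 // => T _.
  by rewrite mul0r.
(* Feasibility of 0 and the bound [lp_le] make the value finite, so it can serve as the real bound
   [v] of the duality lemma. *)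
have lp_fin : lp_value d (overlap rho) \is a fin_num.
  rewrite fin_numElt (le_lt_trans lp_le (ltry _)) andbT.
  exact: lt_le_trans (ltNyr _) (feasible_lp _ _ feasible0).
have lpE := fineK lp_fin; rewrite -lpE lee_fin.
have [w q fwq|lam [mup [mum [[lam0 mu0] lam_sum lamE le_v]]]] :=
  lp_dual_solution R V adj d d_gt1 (overlap rho) (fine (lp_value d (overlap rho))).
  by rewrite -lee_fin lpE; exact: feasible_lp fwq.
apply: le_trans le_v.
have rho_phi := white_noised_edge_tensorE R V adj d d_gt1 p rho rhoE.
by apply: gme_negativity_le_dual lam0 mu0 lam_sum lamE.
Qed.
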